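(* Suppose $F$ is a $\mu$-PL function for some $\mu>0$. Let $b\le n$, let $m\ge1$ be an integer, and let $\eta=\rho/L$ where $0<\rho\le 1/5$ satisfies $$\frac{4\rho^2m^2}{b}+\rho\le 1,$$ and let $T=\lceil 6L/(\rho\mu)\rceil$. Then for every integer $K\ge 1$, the output $x^K$ of PL-SVRG$(x^0,K,T,m,b,\eta)$ satisfies $$\mathbb E\big[F(x^K)-F(x^* )\big]\le \frac{F(x^0)-F(x^* )}{2^K},$$ where $x^*$ is an optimal solution of $\min_x F(x)$.
   Context: Setting: Let $n,d\ge 1$ be integers and $[n]=\{1,\dots,n\}$. Let $f_1,\dots,f_n:\mathbb R^d\to\mathbb R$ be differentiable (possibly nonconvex) functions, each $L$-smooth for some $L>0$, i.e. $\|\nabla f_i(x)-\nabla f_i(y)\|\le L\|x-y\|$ for all $x,y\in\mathbb R^d$ and $i\in[n]$. Let $f=\frac1n\sum_{i=1}^n f_i$. Let $h:\mathbb R^d\to\mathbb R\cup\{+\infty\}$ be proper, lower semicontinuous and convex, with closed domain. Let $F=f+h$, and let $x^*$ be a global minimizer of $F$ on $\mathbb R^d$ (assumed to exist). For $\eta>0$, $\mathrm{prox}_{\eta h}(x):=\arg\min_{y\in\mathbb R^d}\big(h(y)+\frac1{2\eta}\|y-x\|^2\big)$. $\mu$-PL functions: for $x\in\mathbb R^d$ and $\alpha>0$ define $D_h(x,\alpha):=-2\alpha\min_{y\in\mathbb R^d}\big[\langle\nabla f(x),y-x\rangle+\frac{\alpha}{2}\|y-x\|^2+h(y)-h(x)\big]$.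 $F$ is called $\mu$-PL ($\mu>0$) if $\mu\,(F(x)-F(x^* ))\le \frac12 D_h(x,\mu)$ for all $x\in\mathrm{dom}(h)$. Algorithm ProxSVRG$(x^0,T,m,b,\eta)$: Given $x^0\in\mathbb R^d$, positive integers $T,m,b$ and $\eta>0$, let $S=\lceil T/m\rceil$ and set $\tilde x^0=x^0_m=x^0$. For $s=0,\dots,S-1$: set $x^{s+1}_0=x^s_m$ and $g^{s+1}=\frac1n\sum_{i=1}^n\nabla f_i(\tilde x^s)$; for $t=0,\dots,m-1$: draw a multiset $I_t$ of $b$ indices, each drawn independently and uniformly at random from $[n]$ (with replacement, independently of all previous draws), set $v^{s+1}_t=\frac1b\sum_{i\in I_t}\big(\nabla f_i(x^{s+1}_t)-\nabla f_i(\tilde x^s)\big)+g^{s+1}$ and $x^{s+1}_{t+1}=\mathrm{prox}_{\eta h}(x^{s+1}_t-\eta v^{s+1}_t)$; after the inner loop set $\tilde x^{s+1}=x^{s+1}_m$. The output $x_a$ is chosen uniformly at random from $\{x^{s+1}_t: 0\le t\le m-1,\ 0\le s\le S-1\}$. Algorithm PL-SVRG$(x^0,K,T,m,b,\eta)$: for $k=1,\dots,K$, let $x^k$ be the output $x_a$ of ProxSVRG$(x^{k-1},T,m,b,\eta)$ (run with fresh independent randomness); output $x^K$. Expectations are over all randomness. *)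

(* Defs.v *)
From Stdlib Require Import Reals.
From mathcomp Require Import all_boot.
Set Implicit Arguments.
Unset Strict Implicit.
Open Scope R_scope.

Definition vec (d : nat) := 'I_d -> R.
Definition vadd (d : nat) (u v : vec d) : vec d := fun i => u i + v i.
Definition vsub (d : nat) (u v : vec d) : vec d := fun i => u i - v i.
Definition vscale (d : nat) (a : R) (u : vec d) : vec d := fun i => a * u i.
Definition dot (d : nat) (u v : vec d) : R := \big[Rplus/0]_(i < d) (u i * v i).
Definition norm (d : nat) (u : vec d) : R := sqrt (dot u u).

Definition has_gradient (d : nat) (f : vec d -> R) (g : vec d -> vec d) : Prop :=
  forall x : vec d, forall eps, 0 < eps -> exists delta, 0 < delta /\
    forall y : vec d, norm (vsub y x) < delta ->
      Rabs (f y - f x - dot (g x) (vsub y x)) <= eps * norm (vsub y x).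

Definition L_smooth (d : nat) (L : R) (g : vec d -> vec d) : Prop :=
  forall x y : vec d, norm (vsub (g x) (g y)) <= L * norm (vsub x y).

(* An extended-valued h : R^d -> R u {+oo} is represented by its effective
   domain hdom and its (finite) values hval on hdom; h x = +oo iff ~ hdom x. *)
Definition proper_ext (d : nat) (hdom : vec d -> Prop) : Prop := exists x, hdom x.

Definition closed_vset (d : nat) (C : vec d -> Prop) : Prop :=
  forall x : vec d, (forall eps, 0 < eps -> exists y, C y /\ norm (vsub y x) < eps) -> C x.

Definition convex_ext (d : nat) (hdom : vec d -> Prop) (hval : vec d -> R) : Prop :=
  forall x y : vec d, forall t, hdom x -> hdom y -> 0 <= t <= 1 ->
    hdom (vadd (vscale t x) (vscale (1 - t) y)) /\
    hval (vadd (vscale t x) (vscale (1 - t) y)) <= t * hval x + (1 - t) * hval y.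

(* lower semicontinuity of the extended-valued function; points outside the
   domain have value +oo, so only points x of the domain and nearby points y
   of the domain impose a constraint. *)
Definition lsc_ext (d : nat) (hdom : vec d -> Prop) (hval : vec d -> R) : Prop :=
  forall x : vec d, hdom x -> forall eps, 0 < eps -> exists delta, 0 < delta /\
    forall y : vec d, hdom y -> norm (vsub y x) < delta -> hval x - eps < hval y.

Definition is_prox (d : nat) (hdom : vec d -> Prop) (hval : vec d -> R)
    (eta : R) (x p : vec d) : Prop :=
  hdom p /\ forall y : vec d, hdom y ->
    hval p + / (2 * eta) * (norm (vsub p x)) ^ 2 <= hval y + / (2 * eta) * (norm (vsub y x)) ^ 2.

Section Problem.
Variables (n d : nat) (f : 'I_n -> vec d -> R) (grad : 'I_n -> vec d -> vec d)
          (hdom : vec d -> Prop) (hval : vec d -> R).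

Definition favg (x : vec d) : R := / INR n * \big[Rplus/0]_(i < n) f i x.
Definition fullgrad (x : vec d) : vec d :=
  fun j => / INR n * \big[Rplus/0]_(i < n) grad i x j.
Definition Fval (x : vec d) : R := favg x + hval x.

Definition is_global_min (xs : vec d) : Prop :=
  hdom xs /\ forall x : vec d, hdom x -> Fval xs <= Fval x.

(* the objective inside D_h(x, alpha) (value +oo outside dom h) *)
Definition Dh_obj (alpha : R) (x y : vec d) : R :=
  dot (fullgrad x) (vsub y x) + alpha / 2 * (norm (vsub y x)) ^ 2 + hval y - hval x.

(* mu-PL: for x in dom h, with y0 the minimizer in the definition of
   D_h(x,mu) = -2 mu Dh_obj mu x y0, mu (F x - F x* ) <= 1/2 D_h(x,mu). *)
Definition is_PL (mu : R) (xs : vec d) : Prop :=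
  forall x : vec d, hdom x -> forall y0 : vec d,
    hdom y0 -> (forall y, hdom y -> Dh_obj mu x y0 <= Dh_obj mu x y) ->
    mu * (Fval x - Fval xs) <= / 2 * (- 2 * mu * Dh_obj mu x y0).

(* ---- The algorithms; expectations computed exactly over the finite,
   uniform randomness (continuation-passing style: E_.. k = E[k(output)]). *)
Variables (b m : nat) (eta : R) (prox : vec d -> vec d).

(* uniform average over the multiset I_t of b i.i.d. uniform indices *)
Definition avg_batch (F : b.-tuple 'I_n -> R) : R :=
  / (INR n ^ b) * \big[Rplus/0]_(I : b.-tuple 'I_n) F I.

Definition vr_step (xt : vec d) (g : vec d) (x : vec d) (I : b.-tuple 'I_n) : vec d :=
  let v := fun j => / INR b * \big[Rplus/0]_(i <- I) (grad i x j - grad i xt j) + g j in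
  prox (fun j => x j - eta * v j).

(* E[k(x_t)] when starting the inner loop from x with snapshot xt, full grad g *)
Fixpoint inner_E (xt g : vec d) (t : nat) (x : vec d) (k : vec d -> R) : R :=
  match t with
  | O => k x
  | S t' => avg_batch (fun I => inner_E xt g t' (vr_step xt g x I) k)
  end.

(* one outer epoch started at y = x^s_m = tilde x^s; returns x^{s+1}_m *)
Definition epoch_E (y : vec d) (k : vec d -> R) : R :=
  inner_E y (fullgrad y) m y k.

Fixpoint epochs_E (s : nat) (x0 : vec d) (k : vec d -> R) : R :=
  match s with
  | O => k x0
  | S s' => epochs_E s' x0 (fun y => epoch_E y k)
  end.

(* E[k(x_a)] for x_a the output of ProxSVRG(x0,T,m,b,eta); S = ceil(T/m),
   x_a uniform over {x^{s+1}_t : t < m, s < S}. *)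
Definition proxsvrg_E (T : nat) (x0 : vec d) (k : vec d -> R) : R :=
  let S := ((T + m).-1 %/ m)%N in
  / INR (S * m) * \big[Rplus/0]_(s < S) \big[Rplus/0]_(t < m)
     epochs_E s x0 (fun y => inner_E y (fullgrad y) t y k).

Fixpoint plsvrg_E (T K : nat) (x0 : vec d) (k : vec d -> R) : R :=
  match K with
  | O => k x0
  | S K' => proxsvrg_E T x0 (fun x1 => plsvrg_E T K' x1 k)
  end.

End Problem.

(* Main.v *)
(* Let xbar be the exact proximal gradient step from x.  The PL inequality gives
   F xbar <= F x + (L/2 - 1/(2 eta)) |xbar - x|^2 - eta mu (F x - F xstar), and the prox
   inequality gives F xbar <= F x + (L/2 - 1/eta) |xbar - x|^2.  Mixing them with weights
   1/3 and 2/3 and comparing the stochastic step with xbar yields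
   F x_(t+1) <= F x_t - (eta mu / 3) (F x_t - F xstar) + (eta/2) |v_t - grad f x_t|^2
                + (L/2 - 1/(2 eta)) |x_(t+1) - x_t|^2,
   where the variance of v_t is at most (L^2/b) |x_t - xt|^2, xt being the snapshot.
   A Lyapunov function F x_t + c_t |x_t - xt|^2 absorbs the variance over an epoch, because
   (1 + 1/m)^m <= 3; telescoping over S epochs of length m, S m >= T >= 6/(eta mu), halves
   the expected gap. *)
Require Import Defs.
From HB Require Import structures.
From Stdlib Require Import Reals Lra Lia FunctionalExtensionality ClassicalEpsilon.
From mathcomp Require Import all_boot.
Set Implicit Arguments.
Unset Strict Implicit.
Unset Printing Implicit Defensive.
Open Scope R_scope.

(** * Finite sums of real numbers *)

HB.instance Definition _ := Monoid.isComLaw.Build R 0 Rplus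
  (fun x y z => esym (Rplus_assoc x y z)) Rplus_comm Rplus_0_l.
HB.instance Definition _ := Monoid.isMulLaw.Build R 0 Rmult Rmult_0_l Rmult_0_r.
HB.instance Definition _ := Monoid.isAddLaw.Build R Rmult Rplus
  Rmult_plus_distr_r Rmult_plus_distr_l.

Lemma sumR_le (I : Type) (r : seq I) (F G : I -> R) :
  (forall i, F i <= G i) ->
  \big[Rplus/0]_(i <- r) F i <= \big[Rplus/0]_(i <- r) G i.
Proof.
by move=> h; apply: (big_ind2 Rle) => // *; [lra | apply: Rplus_le_compat].
Qed.

Lemma sumR_ge0 (I : Type) (r : seq I) (F : I -> R) :
  (forall i, 0 <= F i) -> 0 <= \big[Rplus/0]_(i <- r) F i.
Proof. by move=> h; apply: big_ind => // *; lra. Qed.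

Lemma sumR_const (I : finType) (c : R) :
  \big[Rplus/0]_(i : I) c = INR #|I| * c.
Proof.
rewrite big_const; elim: #|I| => [|n IH]; first by rewrite /=; ring.
by rewrite iterS IH S_INR; ring.
Qed.

Lemma sumR_scale (I : Type) (r : seq I) (a : R) (F : I -> R) :
  \big[Rplus/0]_(i <- r) (a * F i) = a * \big[Rplus/0]_(i <- r) F i.
Proof. by rewrite big_distrr. Qed.

Lemma sumR_add (I : Type) (r : seq I) (F G : I -> R) :
  \big[Rplus/0]_(i <- r) (F i + G i)
    = \big[Rplus/0]_(i <- r) F i + \big[Rplus/0]_(i <- r) G i.
Proof. exact: big_split. Qed.

Lemma sumR_sub (I : Type) (r : seq I) (F G : I -> R) :
  \big[Rplus/0]_(i <- r) (F i - G i)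
    = \big[Rplus/0]_(i <- r) F i - \big[Rplus/0]_(i <- r) G i.
Proof.
rewrite (_ : _ - \big[_/_]_(i <- r) _ = \big[Rplus/0]_(i <- r) F i
   + -1 * \big[Rplus/0]_(i <- r) G i); last by ring.
by rewrite -sumR_scale -sumR_add; apply: eq_bigr => i _ /=; ring.
Qed.

Lemma Rabs_sumR (I : Type) (r : seq I) (F : I -> R) :
  Rabs (\big[Rplus/0]_(i <- r) F i) <= \big[Rplus/0]_(i <- r) Rabs (F i).
Proof.
apply: (big_ind2 (fun u v => Rabs u <= v)) => [|u1 u2 v1 v2 h1 h2|i _].
- by rewrite Rabs_R0; lra.
- by apply: Rle_trans (Rabs_triang _ _) _; lra.
- exact: Rle_refl.
Qed.

Lemma Rabs_le_bounds (a c : R) : Rabs a <= c -> - c <= a <= c.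
Proof. by have := Rle_abs a; have := Rle_abs (- a); rewrite Rabs_Ropp; lra. Qed.

Lemma INR_gt0 (n : nat) : (0 < n)%N -> 0 < INR n.
Proof. by move/ltP; apply: lt_0_INR. Qed.

(** * Euclidean space *)

Section Dot.
Variable d : nat.
Implicit Types u v w : vec d.

Lemma dotC u v : dot u v = dot v u.
Proof. by apply: eq_bigr => i _; ring. Qed.

Lemma dotDl u v w : dot (vadd u v) w = dot u w + dot v w.
Proof. by rewrite /dot -sumR_add; apply: eq_bigr => i _; rewrite /vadd; ring. Qed.

Lemma dotBl u v w : dot (vsub u v) w = dot u w - dot v w.
Proof. by rewrite /dot -sumR_sub; apply: eq_bigr => i _; rewrite /vsub /=; ring. Qed.

Lemma dotZl a u w : dot (vscale a u) w = a * dot u w.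
Proof. by rewrite /dot -sumR_scale; apply: eq_bigr => i _; rewrite /vscale /=; ring. Qed.

Lemma dotDr u v w : dot w (vadd u v) = dot w u + dot w v.
Proof. by rewrite dotC dotDl !(dotC _ w). Qed.

Lemma dotBr u v w : dot w (vsub u v) = dot w u - dot w v.
Proof. by rewrite dotC dotBl !(dotC _ w). Qed.

Lemma dotZr a u w : dot w (vscale a u) = a * dot w u.
Proof. by rewrite dotC dotZl (dotC _ w). Qed.

Definition dotE := (dotDl, dotDr, dotBl, dotBr, dotZl, dotZr).

Lemma dot_ge0 u : 0 <= dot u u.
Proof. by apply: sumR_ge0 => i; nra. Qed.

Lemma sqr_norm u : norm u ^ 2 = dot u u.
Proof. by rewrite /norm pow2_sqrt //; apply: dot_ge0. Qed.

Lemma norm_ge0 u : 0 <= norm u.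
Proof. exact: sqrt_pos. Qed.

Lemma sqr_coord_le u i : u i ^ 2 <= dot u u.
Proof.
rewrite /dot (bigD1 i) //= big_mkcond /=.
set s := \big[_/_]_(j <- _) _.
have : 0 <= s by apply: sumR_ge0 => j; case: ifP => _; nra.
by nra.
Qed.

Lemma dot_eq0 u : dot u u <= 0 -> u = fun=> 0.
Proof.
move=> h; apply: functional_extensionality => i.
by apply: Rsqr_0_uniq; have := sqr_coord_le u i; rewrite /Rsqr; nra.
Qed.

Lemma cauchy_schwarz u v : Rabs (dot u v) <= norm u * norm v.
Proof.
have key : dot u v ^ 2 <= dot u u * dot v v.
  have [v0|v0] := Req_dec (dot v v) 0.
    rewrite (dot_eq0 (u := v)); last by lra.
    have z0 w : dot w (fun=> 0) = 0 by rewrite /dot big1 // => i _; ring.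
    by rewrite !z0; lra.
  have := dot_ge0 (vsub (vscale (dot v v) u) (vscale (dot u v) v)).
  rewrite !dotE (dotC v u) => h.
  have := dot_ge0 v => hv; have {v0}hv : 0 < dot v v by lra.
  by apply: (Rmult_le_reg_l (dot v v)) => //; nra.
apply: Rsqr_incr_0_var; last by apply: Rmult_le_pos; apply: norm_ge0.
rewrite -Rsqr_abs !Rsqr_pow2 Rpow_mult_distr !sqr_norm //.
Qed.

Lemma norm_scale a u : norm (vscale a u) = Rabs a * norm u.
Proof.
rewrite /norm !dotE -Rmult_assoc sqrt_mult ?sqrt_Rsqr_abs //; last exact: dot_ge0.
exact: Rle_0_sqr.
Qed.
End Dot.

(** * Smoothness *)

(** The mean value theorem is applied to [phi] minus its quadratic model, whose slope is nonpositive
    on the interval. *)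
Lemma taylor1_bound (phi phi' : R -> R) (M : R) :
  (forall t, derivable_pt_lim phi t (phi' t)) ->
  (forall t, 0 <= t -> phi' t - phi' 0 <= M * t) ->
  phi 1 - phi 0 - phi' 0 <= M / 2.
Proof.
move=> hd hM.
pose psi t := phi t - phi' 0 * t - M / 2 * (t * t).
have hpsi t : derivable_pt_lim psi t (phi' t - phi' 0 - M * t).
  have -> : phi' t - phi' 0 - M * t = phi' t - phi' 0 * 1 - M / 2 * (1 * t + t * 1) by field.
  apply: (derivable_pt_lim_minus (fun t => phi t - phi' 0 * t) (fun t => M / 2 * (t * t))).
    apply: (derivable_pt_lim_minus phi (fun t => phi' 0 * t)) => //.
    exact: (derivable_pt_lim_scal id _ _ _ (derivable_pt_lim_id t)).
  apply: (derivable_pt_lim_scal (fun t => t * t)).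
  exact: (derivable_pt_lim_mult id id _ _ _ (derivable_pt_lim_id t) (derivable_pt_lim_id t)).
have [c [hc c01]] := @MVT_cor2 psi _ 0 1 Rlt_0_1 (fun t _ => hpsi t).
have := hM c ltac:(lra); rewrite /psi in hc; nra.
Qed.

Section Smooth.
Variables (d : nat) (f : vec d -> R) (g : vec d -> vec d) (L : R).
Hypotheses (fg : has_gradient f g) (gL : L_smooth L g).

Let line (x w : vec d) (t : R) : vec d := vadd x (vscale t w).

Lemma derivable_line (x w : vec d) (t : R) :
  derivable_pt_lim (fun t => f (line x w t)) t (dot (g (line x w t)) w).
Proof.
move=> eps heps.
have hn := norm_ge0 w; have hn1 : 0 < norm w + 1 by lra.
(* Dividing by [norm w + 1] rather than [norm w] avoids a separate case [w = 0]. *)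
have [delta [hdelta H]] := fg (line x w t) (Rdiv_lt_0_compat _ _ heps hn1).
exists (mkposreal _ (Rdiv_lt_0_compat _ _ hdelta hn1)) => s s0 /= hs.
have e : vsub (line x w (t + s)) (line x w t) = vscale s w.
  by apply: functional_extensionality => i; rewrite /vsub /line /vadd /vscale; ring.
have sp : 0 < Rabs s by apply: Rabs_pos_lt.
have hs' : Rabs s * (norm w + 1) < delta.
  by apply: (Rmult_lt_reg_r (/ (norm w + 1))); [apply: Rinv_0_lt_compat | field_simplify; lra].
have := H (line x w (t + s)); rewrite e norm_scale dotZr => /(_ ltac:(nra)) {}H.
have -> : (f (line x w (t + s)) - f (line x w t)) / s - dot (g (line x w t)) w
  = (f (line x w (t + s)) - f (line x w t) - s * dot (g (line x w t)) w) / s by field.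
rewrite /Rdiv Rabs_mult Rabs_inv.
apply: (Rmult_lt_reg_r (Rabs s)) => //; rewrite Rmult_assoc Rinv_l; last by lra.
rewrite Rmult_1_r; apply: Rle_lt_trans H _.
have -> : eps / (norm w + 1) * (Rabs s * norm w) = Rabs s * eps * (norm w / (norm w + 1)).
  by field; lra.
rewrite (Rmult_comm eps) -[X in _ < X]Rmult_1_r; apply: Rmult_lt_compat_l; first by nra.
by apply: (Rmult_lt_reg_r (norm w + 1)) => //; field_simplify; lra.
Qed.

(** Restriction to the segment reduces the claim to one variable. Both signs matter: without
    convexity of [f], the lower bound is needed at comparison points. *)
Lemma smooth_descent (x y : vec d) :
  Rabs (f y - f x - dot (g x) (vsub y x)) <= L / 2 * dot (vsub y x) (vsub y x).
Proof.
set w := vsub y x.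
have l0 : line x w 0 = x.
  by apply: functional_extensionality => i; rewrite /line /vadd /vscale; ring.
have l1 : line x w 1 = y.
  by apply: functional_extensionality => i; rewrite /line /w /vsub /vadd /vscale; ring.
have hM t : 0 <= t -> Rabs (dot (g (line x w t)) w - dot (g x) w) <= L * dot w w * t.
  move=> ht; rewrite -dotBl; apply: Rle_trans (cauchy_schwarz _ _) _.
  apply: Rle_trans (Rmult_le_compat_r _ _ _ (norm_ge0 w) (gL _ _)) _.
  have -> : vsub (line x w t) x = vscale t w.
    by apply: functional_extensionality => i; rewrite /line /vsub /vadd /vscale; ring.
  by rewrite norm_scale (Rabs_pos_eq _ ht) -sqr_norm; nra.
have U := @taylor1_bound (fun t => f (line x w t)) _ (L * dot w w) (derivable_line x w).
have D := @taylor1_bound (fun t => - f (line x w t)) _ (L * dot w w)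
  (fun t => derivable_pt_lim_opp _ _ _ (derivable_line x w t)).
rewrite /= l0 l1 in U D.
by apply: Rabs_le; split;
  [have := D _ | have := U _] => /(_ ltac:(by move=> t /hM /Rabs_le_bounds; lra)); lra.
Qed.
End Smooth.

(** * Strongly convex minimization *)

(** This stands in for the limit [t -> 0]; the witness makes [t * Rabs e] at most half of
    [a - b]. *)
Lemma le_of_le_add_mul (a b e : R) :
  (forall t, 0 < t < 1 -> a <= b + t * e) -> a <= b.
Proof.
move=> h; apply: Rnot_lt_le => lt_ba.
have e0 := Rabs_pos e; have ee := Rle_abs e.
have hp : 0 < Rabs e + (a - b) by lra.
have h1 : 0 < (a - b) / (2 * (Rabs e + (a - b))) by apply: Rdiv_lt_0_compat; lra.
have h2 : (a - b) / (2 * (Rabs e + (a - b))) * (2 * (Rabs e + (a - b))) = a - b by field; lra.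
set t := _ / _ in h1 h2.
have t1 : t < 1 by nra.
by have := h t (conj h1 t1); nra.
Qed.

Lemma Un_cv_sumR (I : Type) (r : seq I) (u : I -> nat -> R) (l : I -> R) :
  (forall i, Un_cv (u i) (l i)) ->
  Un_cv (fun k => \big[Rplus/0]_(i <- r) u i k) (\big[Rplus/0]_(i <- r) l i).
Proof.
move=> h; elim: r => [|i r IH].
  by move=> e he; exists 0%N => k _; rewrite !big_nil R_dist_eq.
move=> e he; rewrite big_cons.
have [N hN] := CV_plus _ _ _ _ (h i) IH e he.
by exists N => k hk; rewrite big_cons; apply: hN.
Qed.

Lemma vec_complete (d : nat) (y : nat -> vec d) :
  (forall eps, 0 < eps -> exists N, forall k l, (k >= N)%coq_nat -> (l >= N)%coq_nat ->
     dot (vsub (y k) (y l)) (vsub (y k) (y l)) < eps) ->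
  exists z, Un_cv (fun k => dot (vsub (y k) z) (vsub (y k) z)) 0.
Proof.
move=> hC.
have hci i : Cauchy_crit (fun k => y k i).
  move=> eps heps; have [N hN] := hC (eps ^ 2) ltac:(nra).
  exists N => k l hk hl; have := hN k l hk hl.
  have := sqr_coord_le (vsub (y k) (y l)) i; rewrite /vsub /R_dist => h1 h2.
  by apply: Rabs_def1; nra.
exists (fun i => proj1_sig (R_complete _ (hci i))).
have -> : 0 = \big[Rplus/0]_(i < d) 0 by rewrite big1.
apply: Un_cv_sumR => i; rewrite /vsub; case: (R_complete _ _) => l /= hl.
have hl0 : Un_cv (fun k => y k i - l) 0.
  have -> : 0 = l - l by ring.
  apply: CV_minus => // e he; exists 0%N => k _; by rewrite R_dist_eq.
by have := CV_mult _ _ _ _ hl0 hl0; rewrite Rmult_0_l.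
Qed.

(* Minimizing sequences are Cauchy by uniform midpoint convexity. *)
Lemma exists_minimizer (d : nat) (C : vec d -> Prop) (phi : vec d -> R) (c lb : R) :
  (exists x, C x) -> closed_vset C -> lsc_ext C phi -> 0 < c ->
  (forall y z, C y -> C z ->
     C (vadd (vscale (/ 2) y) (vscale (1 - / 2) z)) /\
     phi (vadd (vscale (/ 2) y) (vscale (1 - / 2) z)) + c * dot (vsub y z) (vsub y z)
       <= (phi y + phi z) / 2) ->
  (forall y, C y -> lb <= phi y) ->
  exists y0, C y0 /\ forall y, C y -> phi y0 <= phi y.
Proof.
move=> [x0 hx0] hcl hlsc c0 hmid hlb.
(* [completeness] gives suprema, so the infimum of [phi] is obtained as [- M] from negated
   values. *)
pose E r := exists y, C y /\ r = - phi y.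
have [M [hM1 hM2]] : {M | is_lub E M}.
  apply: completeness; last by exists (- phi x0), x0.
  by exists (- lb) => _ [y [hy ->]]; have := hlb y hy; lra.
have hinf y : C y -> - M <= phi y.
  by move=> hy; have := hM1 (- phi y) (ex_intro _ y (conj hy erefl)); lra.
have inv0 k : 0 < / (INR k + 1) by apply: Rinv_0_lt_compat; have := pos_INR k; lra.
have hseq k : exists y, C y /\ phi y <= - M + / (INR k + 1).
  apply: NNPP => hn.
  suff : M <= M - / (INR k + 1) by have := inv0 k; lra.
  apply: hM2 => _ [y [hy ->]].
  by apply: Rnot_lt_le => h; apply: hn; exists y; split => //; lra.
pose y k := proj1_sig (constructive_indefinite_description _ (hseq k)).
have hyC k : C (y k) by rewrite /y; case: constructive_indefinite_description => ? [].
have hyv k : phi (y k) <= - M + / (INR k + 1).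
  by rewrite /y; case: constructive_indefinite_description => ? [].
have small eps : 0 < eps -> exists N, forall k, (k >= N)%coq_nat -> / (INR k + 1) < eps.
  move=> he; have [N hN] := archimed_cor1 eps he.
  exists N => k hk; apply: Rlt_trans (proj1 hN).
  apply: Rinv_lt_contravar.
    by apply: Rmult_lt_0_compat; [apply: lt_0_INR; lia | have := pos_INR k; lra].
  by have := le_INR _ _ hk; lra.
(* The midpoint of [y k] and [y l] has value at least [- M], so [c] times their squared distance is
   at most the mean of their excesses over [- M]. *)
have [z hz] : exists z, Un_cv (fun k => dot (vsub (y k) z) (vsub (y k) z)) 0.
  apply: vec_complete => eps he.
  have [N hN] := small (c * eps) ltac:(nra).
  exists N => k l hk hl.
  have [hm1 hm2] := hmid _ _ (hyC k) (hyC l).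
  have := hinf _ hm1; have := hyv k; have := hyv l; have := hN k hk; have := hN l hl.
  by move=> *; apply: (Rmult_lt_reg_l c) => //; lra.
have hzn eps : 0 < eps -> exists N, forall k, (k >= N)%coq_nat -> norm (vsub (y k) z) < eps.
  move=> he; have [N hN] := hz (eps ^ 2) ltac:(nra).
  exists N => k hk; have := hN k hk; rewrite /R_dist Rminus_0_r => /Rabs_def2 [h _].
  rewrite -sqr_norm in h; have := norm_ge0 (vsub (y k) z); nra.
have hzC : C z.
  by apply: hcl => eps /hzn [N hN]; exists (y N); split => //; apply: hN.
exists z; split => // w hw.
suff : phi z <= - M by have := hinf w hw; lra.
apply: (@le_of_le_add_mul _ _ 2) => eps [he _].
have [delta [hd hl]] := hlsc z hzC eps he.
have [N1 hN1] := hzn _ hd; have [N2 hN2] := small _ he.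
have := hl (y (N1 + N2)%N) (hyC _) (hN1 _ ltac:(by apply/leP; apply: leq_addr)).
have := hN2 (N1 + N2)%N ltac:(by apply/leP; apply: leq_addl).
by have := hyv (N1 + N2)%N; lra.
Qed.

(** The right side is [|v + mu u|^2 / (2 mu)]. It serves both to bound quadratic models below and as
    Young's inequality. *)
Lemma dot_completing_square (d : nat) (v u : vec d) (mu : R) :
  0 < mu -> 0 <= dot v v / (2 * mu) + dot v u + mu / 2 * dot u u.
Proof.
move=> hmu; apply: (Rmult_le_reg_l (2 * mu)); first lra.
have := dot_ge0 (vadd v (vscale mu u)); rewrite !dotE (dotC u v) => h.
have -> : 2 * mu * (dot v v / (2 * mu) + dot v u + mu / 2 * dot u u)
  = dot v v + 2 * mu * dot v u + mu * mu * dot u u by field; lra.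
lra.
Qed.

(** * Proximal points and minimizers of quadratic models *)

Section Prox.
Variables (d : nat) (hdom : vec d -> Prop) (hval : vec d -> R).
Hypotheses (hcv : convex_ext hdom hval).

(** Compare [p] with [t z + (1 - t) p], divide by [t] and let [t] tend to 0; the extra [|z - p|^2]
    is the gain from strong convexity of the prox objective. *)
Lemma prox_three_point (eta : R) (w p z : vec d) :
  0 < eta -> is_prox hdom hval eta w p -> hdom z ->
  hval p + / (2 * eta) * (dot (vsub p w) (vsub p w) + dot (vsub z p) (vsub z p))
    <= hval z + / (2 * eta) * dot (vsub z w) (vsub z w).
Proof.
move=> he [hp hmin] hz.
have hc : 0 < / (2 * eta) by apply: Rinv_0_lt_compat; lra.
apply: (@le_of_le_add_mul _ _ (/ (2 * eta) * dot (vsub z p) (vsub z p))) => t ht.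
have [hq1 hq2] := hcv hz hp (t := t) ltac:(lra).
have := hmin _ hq1; rewrite !sqr_norm.
set c := / (2 * eta) in hc *; set q := hval (vadd _ _) in hq2 *.
rewrite !dotE (dotC p z) (dotC w z) (dotC w p) => h.
apply: (Rmult_le_reg_l t); first lra.
nra.
Qed.

(* The proximal point [p] provides an affine minorant of [hval], so the model is bounded below. *)
Lemma exists_quadratic_model_min (eta mu : R) (w x p g : vec d) :
  0 < eta -> 0 < mu -> closed_vset hdom -> lsc_ext hdom hval -> is_prox hdom hval eta w p ->
  exists y0, hdom y0 /\ forall y, hdom y ->
   dot g (vsub y0 x) + mu / 2 * norm (vsub y0 x) ^ 2 + hval y0 - hval x
   <= dot g (vsub y x) + mu / 2 * norm (vsub y x) ^ 2 + hval y - hval x.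
Proof.
move=> he hmu hcl hls hp.
have hc : 0 < / (2 * eta) by apply: Rinv_0_lt_compat; lra.
pose c := / (2 * eta).
(* The three-point inequality bounds [hval] below by an affine function of slope [- 2 c (p - w)].
   Adding [g] gives [v], and completing the square in [y - x] gives [lb]. *)
pose v := vsub g (vscale (2 * c) (vsub p w)).
pose lb := hval p + c * (dot (vsub p w) (vsub p w) + dot (vsub p x) (vsub p x)
  - dot (vsub w x) (vsub w x)) - hval x - dot v v / (2 * mu).
(* At a midpoint the quadratic term gains a quarter of [mu / 2], hence [mu / 8]. *)
apply: (@exists_minimizer _ hdom _ (mu / 8) lb) => //; first by exists p; case: hp.
- move=> y hy eps heps; have [del [hdel H]] := hls y hy (eps / 2) ltac:(lra).
  (* [G] is the length of the gradient of the quadratic part at [y]. That part is convex, so moving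
     to [z] lowers it by at most [G * norm (vsub z y)], less than [eps / 2]. *)
  pose G := norm (vadd g (vscale mu (vsub y x))).
  have hG : 0 <= G := norm_ge0 _.
  exists (Rmin del (eps / (2 * (G + 1)))); split.
    by apply: Rmin_pos => //; apply: Rdiv_lt_0_compat; lra.
  move=> z hz hzn.
  have h1 := H z hz (Rlt_le_trans _ _ _ hzn (Rmin_l _ _)).
  have h2 := Rlt_le_trans _ _ _ hzn (Rmin_r _ _).
  have h3 : norm (vsub z y) * (2 * (G + 1)) < eps.
    apply: (Rmult_lt_reg_r (/ (2 * (G + 1)))); first by apply: Rinv_0_lt_compat; lra.
    by rewrite Rmult_assoc Rinv_r; lra.
  have h0 := norm_ge0 (vsub z y).
  have [h4 _] := Rabs_le_bounds (cauchy_schwarz (vadd g (vscale mu (vsub y x))) (vsub z y)).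
  have h5 := dot_ge0 (vsub z y).
  move: h4 h5; rewrite -/G !sqr_norm !dotE (dotC z y) (dotC z x) (dotC y x) => h4 h5.
  nra.
- by lra.
- move=> y z hy hz; have [hq1 hq2] := hcv hy hz (t := / 2) ltac:(lra).
  split => //; set q := hval (vadd _ _) in hq2 *.
  by rewrite !sqr_norm !dotE (dotC x y) (dotC x z) (dotC z y); lra.
- move=> y hy; have := prox_three_point he hp hy; rewrite -/c => h.
  have := dot_completing_square v (vsub y x) hmu.
  rewrite /lb sqr_norm; set V := dot v v / _.
  rewrite /v.
  move: h; rewrite !dotE (dotC x y) (dotC x p) (dotC p y) (dotC w y) (dotC w p) (dotC x w) => h1 h2.
  rewrite -/c in h1; nra.
Qed.
End Prox.

(** * Mini-batch variance *)

Section Batch.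
Variable n : nat.
Hypothesis n0 : (0 < n)%N.

Lemma sum_tuple_cons (b : nat) (F : b.+1.-tuple 'I_n -> R) :
  \big[Rplus/0]_(I : b.+1.-tuple 'I_n) F I
    = \big[Rplus/0]_(i < n) \big[Rplus/0]_(I : b.-tuple 'I_n) F (cons_tuple i I).
Proof.
rewrite pair_big /=.
rewrite (reindex (fun p : 'I_n * b.-tuple 'I_n => cons_tuple p.1 p.2)) //=.
exists (fun I => (thead I, behead_tuple I)) => [[i I] _|I _] /=.
  by congr pair; apply: val_inj.
by rewrite [RHS](tuple_eta I); apply: val_inj.
Qed.

Lemma sum_batch_const (b : nat) (c : R) :
  \big[Rplus/0]_(I : b.-tuple 'I_n) c = INR n ^ b * c.
Proof.
rewrite sumR_const card_tuple card_ord; congr (_ * _).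
by elim: b => //= b IH; rewrite expnS mult_INR IH.
Qed.

Lemma powINR_gt0 (b : nat) : 0 < INR n ^ b.
Proof. by apply: pow_lt; apply: INR_gt0. Qed.

Lemma avg_batch_le (b : nat) (F G : b.-tuple 'I_n -> R) :
  (forall I, F I <= G I) -> avg_batch F <= avg_batch G.
Proof.
move=> h; apply: Rmult_le_compat_l; last exact: sumR_le.
by apply: Rlt_le; apply: Rinv_0_lt_compat; apply: powINR_gt0.
Qed.

Lemma avg_batch_linear (b : nat) (a : R) (F G : b.-tuple 'I_n -> R) :
  avg_batch (fun I => a * F I + G I) = a * avg_batch F + avg_batch G.
Proof. by rewrite /avg_batch sumR_add sumR_scale /=; ring. Qed.

Lemma avg_batch_const (b : nat) (c : R) : avg_batch (fun _ : b.-tuple 'I_n => c) = c.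
Proof. by rewrite /avg_batch sum_batch_const; field; have := powINR_gt0 b; lra. Qed.

Lemma avg_batch_sum (b : nat) (J : Type) (r : seq J) (a : R) (F : J -> b.-tuple 'I_n -> R) :
  avg_batch (fun I => \big[Rplus/0]_(j <- r) (a * F j I))
    = \big[Rplus/0]_(j <- r) (a * avg_batch (F j)).
Proof.
rewrite /avg_batch exchange_big /= -sumR_scale; apply: eq_bigr => j _.
by rewrite sumR_scale; ring.
Qed.

(** Splitting off the first index replaces [c] by [c + xi i], so the induction on [b] needs [c]
    arbitrary; the cross term [2 c xi i] vanishes on summing over [i]. *)
Lemma sum_sq_batch (b : nat) (xi : 'I_n -> R) (c : R) :
  \big[Rplus/0]_(i < n) xi i = 0 ->
  \big[Rplus/0]_(I : b.-tuple 'I_n) (c + \big[Rplus/0]_(i <- I) xi i) ^ 2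
    = INR n ^ b * (c ^ 2 + INR b * (/ INR n * \big[Rplus/0]_(i < n) xi i ^ 2)).
Proof.
move=> hxi; have hn := INR_gt0 n0; set V := \big[_/_]_(i < n) (_ ^ 2).
elim: b c => [|b IH] c.
  rewrite (eq_bigr (fun=> c ^ 2)) => [|I _]; last by rewrite tuple0 big_nil Rplus_0_r.
  by rewrite sum_batch_const [INR 0]/=; ring.
rewrite sum_tuple_cons.
rewrite (eq_bigr (fun i => INR n ^ b * ((c ^ 2 + INR b * (/ INR n * V)) + (2 * c * xi i + xi i ^ 2)))).
  rewrite sumR_scale sumR_add sumR_const card_ord.
  rewrite sumR_add sumR_scale hxi -/V S_INR -[INR n ^ b.+1]/(INR n * INR n ^ b).
  by field; lra.
move=> i _; rewrite (eq_bigr (fun I : b.-tuple 'I_n => ((c + xi i) + \big[Rplus/0]_(j <- I) xi j) ^ 2)).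
  by rewrite IH; ring.
by move=> I _; rewrite big_cons; ring.
Qed.

(** After centring, independence of the draws gives [/ INR b] times the population variance;
    dropping the squared mean leaves the second moment. *)
Lemma batch_variance (b : nat) (a : 'I_n -> R) :
  (0 < b)%N ->
  avg_batch (fun I : b.-tuple 'I_n =>
     (/ INR b * \big[Rplus/0]_(i <- I) a i - / INR n * \big[Rplus/0]_(i < n) a i) ^ 2)
  <= / INR b * (/ INR n * \big[Rplus/0]_(i < n) a i ^ 2).
Proof.
move=> b0; have hn := INR_gt0 n0; have hb := INR_gt0 b0.
set abar := / INR n * \big[_/_]_(i < n) a i.
have hsum : \big[Rplus/0]_(i < n) a i = INR n * abar by rewrite /abar; field; lra.
have hxi : \big[Rplus/0]_(i < n) (a i - abar) = 0.
  by rewrite sumR_sub sumR_const card_ord hsum; ring.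
rewrite /avg_batch (eq_bigr (fun I : b.-tuple 'I_n =>
   / INR b ^ 2 * (0 + \big[Rplus/0]_(i <- I) (a i - abar)) ^ 2)); last first.
  move=> I _; rewrite sumR_sub.
  have -> : \big[Rplus/0]_(i <- I) abar = INR b * abar.
    by rewrite big_tuple sumR_const card_ord.
  by field; lra.
rewrite sumR_scale (sum_sq_batch b 0 hxi).
have -> : \big[Rplus/0]_(i < n) (a i - abar) ^ 2
    = \big[Rplus/0]_(i < n) a i ^ 2 - INR n * abar ^ 2.
  rewrite (eq_bigr (fun i => (a i ^ 2 - 2 * abar * a i) + abar ^ 2)) => [|i _]; last by ring.
  by rewrite sumR_add sumR_sub sumR_scale sumR_const card_ord hsum /=; ring.
have hp := powINR_gt0 b.
set V := \big[_/_]_(i < n) _.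
have -> : / INR n ^ b * (/ INR b ^ 2 * (INR n ^ b *
    (0 ^ 2 + INR b * (/ INR n * (V - INR n * abar ^ 2)))))
  = / INR b * (/ INR n * V) - / INR b * abar ^ 2 by field; lra.
have : 0 <= / INR b * abar ^ 2.
  by apply: Rmult_le_pos; [apply: Rlt_le; apply: Rinv_0_lt_compat | nra].
lra.
Qed.
End Batch.

(** * One proximal step *)

Section Step.
Variables (n d : nat) (f : 'I_n -> vec d -> R) (grad : 'I_n -> vec d -> vec d).
Variables (L : R) (hdom : vec d -> Prop) (hval : vec d -> R) (xstar : vec d) (mu eta : R).
Hypotheses (n0 : (0 < n)%N) (L0 : 0 < L).
Hypotheses (fgrad : forall i, has_gradient (f i) (grad i)).
Hypotheses (gradL : forall i, L_smooth L (grad i)).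
Hypotheses (hcl : closed_vset hdom) (hcv : convex_ext hdom hval) (hlsc : lsc_ext hdom hval).
Hypotheses (hmin : is_global_min f hdom hval xstar).
Hypotheses (mu0 : 0 < mu) (hPL : is_PL f grad hdom hval mu xstar).
Hypotheses (eta0 : 0 < eta) (etaL : L * eta <= / 5).

Let F := Fval f hval.
Let G := fullgrad grad.
Let gap (x : vec d) := F x - F xstar.

Lemma gap_ge0 x : hdom x -> 0 <= gap x.
Proof. by case: hmin => _ h /h; rewrite /gap /F; lra. Qed.

Lemma dot_avg_grad x w :
  dot (fullgrad grad x) w = / INR n * \big[Rplus/0]_(i < n) dot (grad i x) w.
Proof.
rewrite /dot exchange_big /= -sumR_scale; apply: eq_bigr => j _.
rewrite /fullgrad Rmult_assoc; congr (_ * _).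
by rewrite Rmult_comm -sumR_scale; apply: eq_bigr => i _; ring.
Qed.

Lemma favg_descent x y :
  Rabs (favg f y - favg f x - dot (G x) (vsub y x)) <= L / 2 * dot (vsub y x) (vsub y x).
Proof.
have hn := INR_gt0 n0.
rewrite dot_avg_grad /favg -!Rmult_minus_distr_l -!sumR_sub Rabs_mult.
have hi : 0 < / INR n by apply: Rinv_0_lt_compat.
rewrite (Rabs_pos_eq _ (Rlt_le _ _ hi)).
apply: (Rmult_le_reg_l (INR n)) => //; rewrite -Rmult_assoc Rinv_r ?Rmult_1_l; last by lra.
apply: Rle_trans (Rabs_sumR _ _) _.
have <- : \big[Rplus/0]_(i < n) (L / 2 * dot (vsub y x) (vsub y x))
    = INR n * (L / 2 * dot (vsub y x) (vsub y x)) by rewrite sumR_const card_ord.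
by apply: sumR_le => i; apply: smooth_descent.
Qed.

Lemma prox_dist_expand (x v y z : vec d) :
  / (2 * eta) * dot (vsub y (vsub x (vscale eta v))) (vsub y (vsub x (vscale eta v)))
  - / (2 * eta) * dot (vsub z (vsub x (vscale eta v))) (vsub z (vsub x (vscale eta v)))
  = / (2 * eta) * (dot (vsub y x) (vsub y x) - dot (vsub z x) (vsub z x)) + dot v (vsub y z).
Proof.
rewrite !dotE (dotC x y) (dotC x z) (dotC v x) (dotC v y) (dotC v z).
by field; lra.
Qed.

(** Adds the upper smoothness bound at [p], the lower one at [z] and the three-point inequality. The
    error of the arbitrary direction [v] enters only through one inner product. *)
Lemma prox_step_bound (x v p z : vec d) :
  is_prox hdom hval eta (vsub x (vscale eta v)) p -> hdom z ->
  F p <= F z + dot (vsub (G x) v) (vsub p z)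
    + (L / 2 - / (2 * eta)) * dot (vsub p x) (vsub p x)
    + (L / 2 + / (2 * eta)) * dot (vsub z x) (vsub z x)
    - / (2 * eta) * dot (vsub z p) (vsub z p).
Proof.
move=> hp hz; have h3 := prox_three_point hcv eta0 hp hz.
have he := prox_dist_expand x v p z.
have [_ h1] := Rabs_le_bounds (favg_descent x p).
have [h2 _] := Rabs_le_bounds (favg_descent x z).
have e1 : dot (vsub (G x) v) (vsub p z)
    = dot (G x) (vsub p x) - dot (G x) (vsub z x) - dot v (vsub p z).
  by rewrite !dotE; ring.
rewrite e1 /F /Fval; lra.
Qed.

(* Either [mu <= 1/eta], and moving from [x] by the factor [mu eta] towards the
   minimizer defining [D_h x mu] loses only this factor, or [mu > L], and then the PL
   inequality forces every point of the domain to be optimal. *)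
Lemma prox_model_decrease (x p : vec d) :
  hdom x -> is_prox hdom hval eta (vsub x (vscale eta (G x))) p ->
  Dh_obj grad hval (/ eta) x p <= - (eta * mu * gap x).
Proof.
move=> hx hp; have he : 0 < / eta by apply: Rinv_0_lt_compat.
(* The prox point minimizes the model with parameter [/ eta], whereas PL concerns the model with
   parameter [mu]. *)
have hopt y : hdom y -> Dh_obj grad hval (/ eta) x p <= Dh_obj grad hval (/ eta) x y.
  move=> hy; have := hp.2 y hy; rewrite !sqr_norm => h.
  have := prox_dist_expand x (G x) p y.
  have -> : dot (G x) (vsub p y) = dot (G x) (vsub p x) - dot (G x) (vsub y x).
    by rewrite !dotE; ring.
  rewrite /Dh_obj !sqr_norm -/G (_ : / eta / 2 = / (2 * eta)); last by field; lra.
  lra.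
(* [is_PL] speaks of a given minimizer of the model, so one must first be produced. *)
have [y0 [hy0 hmin0]] := exists_quadratic_model_min hcv x (G x) eta0 mu0 hcl hlsc hp.
have hpl : gap x <= - Dh_obj grad hval mu x y0.
  apply: (Rmult_le_reg_l mu) => //.
  by have := hPL hx hy0 hmin0; rewrite /gap /F; lra.
have [small|large] := Rle_or_lt (eta * mu) 1.
  have ht : 0 <= eta * mu <= 1 by nra.
  have [hq1 hq2] := hcv hy0 hx ht.
  apply: Rle_trans (hopt _ hq1) _.
  have ez : vsub (vadd (vscale (eta * mu) y0) (vscale (1 - eta * mu) x)) x
      = vscale (eta * mu) (vsub y0 x).
    by apply: functional_extensionality => i; rewrite /vsub /vadd /vscale; ring.
  move: hpl; rewrite /Dh_obj ez !sqr_norm !dotZl !dotZr.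
  set q := hval (vadd _ _) in hq2 *; set D := dot (vsub y0 x) _.
  have -> : / eta / 2 * (eta * mu * (eta * mu * D)) = eta * mu * (mu / 2 * D) by field; lra.
  move=> h; have := Rmult_le_compat_l (eta * mu) _ _ ltac:(nra) h.
  rewrite -/G; lra.
have h0 : Dh_obj grad hval (/ eta) x p <= 0.
  apply: Rle_trans (hopt x hx) _; rewrite /Dh_obj !sqr_norm !dotE; lra.
suff : gap x <= 0 by have : 0 < eta * mu by [nra]; nra.
have muL : L < mu by apply: (Rmult_lt_reg_r eta) => //; lra.
have [_ hd] := Rabs_le_bounds (favg_descent x y0).
have hy1 := gap_ge0 hy0.
move: hpl hy1; rewrite /Dh_obj sqr_norm /gap /F /Fval -/G => hpl hy1.
(* PL at [x], smoothness between [x] and [y0], and [gap y0 >= 0] add up to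
   [(mu - L) / 2 * |y0 - x|^2 <= 0]. *)
have hD : vsub y0 x = fun=> 0.
  apply: dot_eq0; apply: Rnot_lt_le => hD.
  by have := Rmult_lt_compat_r _ _ _ hD muL; lra.
have e : y0 = x.
  by apply: functional_extensionality => i; have := f_equal (fun v => v i) hD; rewrite /vsub; lra.
move: hpl; rewrite e !dotE; lra.
Qed.

Lemma step_descent (x p0 p v : vec d) :
  hdom x -> is_prox hdom hval eta (vsub x (vscale eta (G x))) p0 ->
  is_prox hdom hval eta (vsub x (vscale eta v)) p ->
  gap p <= (1 - eta * mu / 3) * gap x + eta / 2 * dot (vsub v (G x)) (vsub v (G x))
    + (L / 2 - / (2 * eta)) * dot (vsub p x) (vsub p x).
Proof.
move=> hx hp0 hp; have he : 0 < / eta by apply: Rinv_0_lt_compat.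
have h1 := prox_step_bound hp hp0.1.
have h2 := prox_step_bound hp0 hx.
have h3 := prox_model_decrease hx hp0.
have [_ h4] := Rabs_le_bounds (favg_descent x p0).
(* The parameter [/ eta] produces [|p0 - p|^2 / (2 eta)], exactly what [h1] subtracts. *)
have h5 := dot_completing_square (vsub (G x) v) (vsub p0 p) he.
have h6 := dot_ge0 (vsub p0 x).
(* With weight 1/3 on [h3] and [h4], and 2/3 on [h2], adding [h1] leaves the coefficient
   [L - 1 / (3 eta)] on [|p0 - x|^2]; this bound makes it nonpositive. *)
have eL : L <= / (3 * eta).
  apply: (Rmult_le_reg_r eta) => //.
  have -> : / (3 * eta) * eta = / 3 by field; lra.
  lra.
have e5 : dot (vsub (G x) v) (vsub (G x) v) / (2 * / eta)
    = eta / 2 * dot (vsub v (G x)) (vsub v (G x)).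
  have -> : eta / 2 = / (2 * / eta) by [field; lra].
  by rewrite /Rdiv; set k := / (2 * _); rewrite !dotE; ring.
have e6 : dot (vsub (G x) v) (vsub p0 p) = - dot (vsub (G x) v) (vsub p p0).
  by rewrite !dotE; ring.
have e7 : dot (vsub (G x) (G x)) (vsub p0 x) = 0 by rewrite dotBl; ring.
have e8 : dot (vsub x x) (vsub x x) = 0 by rewrite !dotE; ring.
have e9 : dot (vsub x p0) (vsub x p0) = dot (vsub p0 x) (vsub p0 x).
  by rewrite !dotE; ring.
rewrite e5 e6 in h5; rewrite e7 e8 e9 in h2.
move: h3; rewrite /Dh_obj sqr_norm -/G => h3.
have ee : / eta = 2 * / (2 * eta) by field; lra.
have e3 : / (3 * eta) = 2 / 3 * / (2 * eta) by field; lra.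
rewrite ee in h3 h5; rewrite e3 in eL.
set c := / (2 * eta) in h1 h2 h3 h5 eL *.
have h7 := Rmult_le_compat_r _ _ _ h6 eL.
move: h1 h2 h3; rewrite /gap /F /Fval; lra.
Qed.

(** * The Lyapunov function along the inner loop *)

Variables (b m : nat) (prox : vec d -> vec d).
Hypotheses (b0 : (0 < b)%N) (m0 : (0 < m)%N).
Hypothesis batch_cond : 4 * (L * eta) ^ 2 * INR m ^ 2 / INR b + L * eta <= 1.
Hypothesis proxP : forall x, is_prox hdom hval eta x (prox x).

Definition vr_gradient (xt x : vec d) (I : b.-tuple 'I_n) : vec d :=
  fun j => / INR b * \big[Rplus/0]_(i <- I) (grad i x j - grad i xt j) + G xt j.

(** In each coordinate [batch_variance] applies to the differences of component gradients, whose
    mean is that coordinate of [G x - G xt]; smoothness then bounds the second moments. *)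
Lemma vr_gradient_variance (xt x : vec d) :
  avg_batch (fun I => dot (vsub (vr_gradient xt x I) (G x)) (vsub (vr_gradient xt x I) (G x)))
    <= L ^ 2 / INR b * dot (vsub x xt) (vsub x xt).
Proof.
have hn := INR_gt0 n0; have hb := INR_gt0 b0.
have hi : 0 < / INR n by apply: Rinv_0_lt_compat.
have hib : 0 < / INR b by apply: Rinv_0_lt_compat.
pose dev j (I : b.-tuple 'I_n) :=
  (/ INR b * \big[Rplus/0]_(i <- I) (grad i x j - grad i xt j)
     - / INR n * \big[Rplus/0]_(i < n) (grad i x j - grad i xt j)) ^ 2.
have -> : avg_batch (fun I => dot (vsub (vr_gradient xt x I) (G x)) (vsub (vr_gradient xt x I) (G x)))
    = \big[Rplus/0]_(j < d) (1 * avg_batch (dev j)).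
  rewrite -avg_batch_sum; congr (_ * _); apply: eq_bigr => I _; apply: eq_bigr => j _.
  rewrite /dev /vsub /vr_gradient /G /fullgrad (sumR_sub (index_enum 'I_n)) /=.
  by set A := \big[_/_]_(i < n) grad i xt j; set B := \big[_/_]_(i < n) grad i x j; ring.
apply: Rle_trans (_ : _ <= \big[Rplus/0]_(j < d)
   (/ INR b * (/ INR n * \big[Rplus/0]_(i < n) (grad i x j - grad i xt j) ^ 2))) _.
  by apply: sumR_le => j; rewrite Rmult_1_l; apply: batch_variance.
rewrite !sumR_scale exchange_big /=.
have -> : L ^ 2 / INR b * dot (vsub x xt) (vsub x xt)
  = / INR b * (/ INR n * \big[Rplus/0]_(i < n) (L ^ 2 * dot (vsub x xt) (vsub x xt))).
  by rewrite sumR_const card_ord; field; lra.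
apply: Rmult_le_compat_l; first lra; apply: Rmult_le_compat_l; first lra.
apply: sumR_le => i.
have -> : \big[Rplus/0]_(j < d) ((grad i x j - grad i xt j) * ((grad i x j - grad i xt j) * 1))
   = dot (vsub (grad i x) (grad i xt)) (vsub (grad i x) (grad i xt)).
  by apply: eq_bigr => j _; rewrite /vsub; ring.
rewrite -!sqr_norm -Rpow_mult_distr.
by apply: pow_incr; split; [apply: norm_ge0 | apply: gradL].
Qed.

(* The solution of [c_(j+1) = (1 + 1/m) c_j + eta L^2 / (2 b)], [c_0 = 0];
   [j] counts the inner steps that remain. *)
Definition lyap_coef (j : nat) : R :=
  eta * L ^ 2 / (2 * INR b) * INR m * ((1 + / INR m) ^ j - 1).

Lemma lyap_coefS j :
  lyap_coef j.+1 = lyap_coef j * (1 + / INR m) + eta / 2 * (L ^ 2 / INR b).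
Proof.
rewrite /lyap_coef -[_ ^ j.+1]/((1 + / INR m) * (1 + / INR m) ^ j).
by have := INR_gt0 b0; have := INR_gt0 m0 => *; field; lra.
Qed.

Lemma lyap_coef_ge0 j : 0 <= lyap_coef j.
Proof.
have hm := INR_gt0 m0; have him : 0 < / INR m by apply: Rinv_0_lt_compat.
have hb : 0 < / (2 * INR b) by apply: Rinv_0_lt_compat; have := INR_gt0 b0; lra.
have h1 : 1 <= (1 + / INR m) ^ j by apply: pow_R1_Rle; lra.
apply: Rmult_le_pos; last by lra.
apply: Rmult_le_pos; last by lra.
apply: Rmult_le_pos; last by lra.
by apply: Rmult_le_pos; [lra | apply: pow2_ge_0].
Qed.

Lemma pow_one_plus_inv_le3 j : (j <= m)%N -> (1 + / INR m) ^ j <= 3.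
Proof.
move=> hj; have hm := INR_gt0 m0; have him : 0 < / INR m by apply: Rinv_0_lt_compat.
have hexp k : (1 + / INR m) ^ k <= exp (INR k * / INR m).
  elim: k => [|k IH]; first by rewrite Rmult_0_l exp_0 /=; lra.
  rewrite S_INR Rmult_plus_distr_r Rmult_1_l exp_plus Rmult_comm.
  apply: Rmult_le_compat => //; [lra | by apply: pow_le; lra |].
  by apply: Rlt_le; apply: exp_ineq1; lra.
apply: Rle_trans exp_le_3; apply: Rle_trans (_ : _ <= (1 + / INR m) ^ m) _.
  by apply: Rle_pow; [lra | apply/leP].
by have := hexp m; rewrite Rinv_r //; lra.
Qed.

(** This is the coefficient left on the squared step length. Since [(1 + 1/m)^j - 1 <= 2] and
    [1 + m <= 2 m], multiplying by [2 eta] reduces it to [batch_cond]. *)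
Lemma lyap_coef_bound j : (j <= m)%N ->
  lyap_coef j * (1 + INR m) + L / 2 - / (2 * eta) <= 0.
Proof.
move=> hj; have hm := INR_gt0 m0; have hb := INR_gt0 b0.
have m1 : 1 <= INR m by apply: (le_INR 1); apply/leP.
have h3 := pow_one_plus_inv_le3 hj.
have hA : 0 < eta * L ^ 2 / (2 * INR b) * INR m.
  apply: Rmult_lt_0_compat => //; apply: Rdiv_lt_0_compat; last by lra.
  by apply: Rmult_lt_0_compat => //; apply: pow_lt.
have h1 : lyap_coef j * (1 + INR m) <= eta * L ^ 2 / (2 * INR b) * INR m * 2 * (2 * INR m).
  apply: Rmult_le_compat; [exact: lyap_coef_ge0 | lra | | lra].
  by rewrite /lyap_coef; apply: Rmult_le_compat_l; lra.
apply: (Rmult_le_reg_l (2 * eta)); first lra.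
have h2 := Rmult_le_compat_l (2 * eta) _ _ ltac:(lra) h1.
have e2 : 2 * eta * (eta * L ^ 2 / (2 * INR b) * INR m * 2 * (2 * INR m))
   = 4 * (L * eta) ^ 2 * INR m ^ 2 / INR b by field; lra.
have e3 : 2 * eta * / (2 * eta) = 1 by field; lra.
rewrite e2 in h2; lra.
Qed.

Lemma young_dist (u v : vec d) (r : R) : 0 < r ->
  dot (vadd u v) (vadd u v) <= (1 + r) * dot u u + (1 + / r) * dot v v.
Proof.
move=> hr; have := dot_completing_square (vscale (-1) v) u hr.
rewrite !dotE (dotC v u).
have -> : -1 * (-1 * dot v v) / (2 * r) = / r * dot v v / 2 by field; lra.
lra.
Qed.

Lemma vr_step_descent (xt x : vec d) (j : nat) :
  (j <= m)%N -> hdom x ->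
  avg_batch (fun I : b.-tuple 'I_n =>
     gap (vr_step grad eta prox xt (G xt) x I)
     + lyap_coef j * dot (vsub (vr_step grad eta prox xt (G xt) x I) xt)
         (vsub (vr_step grad eta prox xt (G xt) x I) xt))
  <= (1 - eta * mu / 3) * gap x + lyap_coef j.+1 * dot (vsub x xt) (vsub x xt).
Proof.
move=> hj hx; have hb := INR_gt0 b0.
set D := dot (vsub x xt) (vsub x xt).
apply: Rle_trans (_ : _ <= avg_batch (fun I => eta / 2 *
    dot (vsub (vr_gradient xt x I) (G x)) (vsub (vr_gradient xt x I) (G x))
   + ((1 - eta * mu / 3) * gap x + lyap_coef j * (1 + / INR m) * D))) _.
  apply: avg_batch_le => // I; set p := vr_step _ _ _ _ _ _ _.
  have hp : is_prox hdom hval eta (vsub x (vscale eta (vr_gradient xt x I))) p by apply: proxP.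
  have h1 := step_descent hx (proxP _) hp.
  (* The choice [r = m] inflates the snapshot distance by only [1 + 1/m] per step; [lyap_coef_bound]
     absorbs the factor [1 + m] on [|p - x|^2]. *)
  have h2 := young_dist (vsub p x) (vsub x xt) (INR_gt0 m0).
  have h3 := lyap_coef_bound hj.
  have -> : vsub p xt = vadd (vsub p x) (vsub x xt).
    by apply: functional_extensionality => i; rewrite /vsub /vadd; ring.
  have h4 := Rmult_le_compat_l _ _ _ (lyap_coef_ge0 j) h2.
  have h5 := dot_ge0 (vsub p x).
  have := Rmult_le_compat_r _ _ _ h5 h3.
  move: h1 h4; rewrite -/D; lra.
rewrite avg_batch_linear avg_batch_const // lyap_coefS.
have := vr_gradient_variance xt x; rewrite -/D => hv.
have := Rmult_le_compat_l (eta / 2) _ _ ltac:(lra) hv; lra.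
Qed.

(** * Expectations as monotone linear functionals *)

(** Expectations act on continuations; a single law covers both sums and multiples. *)
Definition linear_functional (E : (vec d -> R) -> R) :=
  forall a k1 k2, E (fun y => a * k1 y + k2 y) = a * E k1 + E k2.

(** Comparison on [hdom] suffices: iterates are prox values or the starting point, and the descent
    bounds are stated only there. *)
Definition monotone_functional (E : (vec d -> R) -> R) :=
  forall k1 k2, (forall y, hdom y -> k1 y <= k2 y) -> E k1 <= E k2.

Lemma linear_functional0 E : linear_functional E -> E (fun=> 0) = 0.
Proof.
move=> hE; have := hE (-1) (fun=> 0) (fun=> 0).
by rewrite (_ : (fun _ => _) = fun=> 0); [lra | apply: functional_extensionality => y; ring].
Qed.

Lemma linear_functional_sum E (J : Type) (r : seq J) a (k : J -> vec d -> R) :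
  linear_functional E ->
  E (fun y => \big[Rplus/0]_(j <- r) (a * k j y)) = a * \big[Rplus/0]_(j <- r) E (k j).
Proof.
move=> hE; elim: r => [|j r IH].
  rewrite big_nil Rmult_0_r -[RHS](linear_functional0 hE).
  by congr E; apply: functional_extensionality => y; rewrite big_nil.
rewrite big_cons Rmult_plus_distr_l -IH -hE.
by congr E; apply: functional_extensionality => y; rewrite big_cons.
Qed.

Lemma inner_E_linear xt g t x :
  linear_functional (inner_E grad b eta prox xt g t x).
Proof.
elim: t x => [|t IH] x a k1 k2 //=.
rewrite -avg_batch_linear; congr avg_batch.
by apply: functional_extensionality => I; rewrite IH.
Qed.

Lemma inner_E_monotone xt g t x : hdom x ->
  monotone_functional (inner_E grad b eta prox xt g t x).
Proof.
elim: t x => [|t IH] x hx k1 k2 hk /=; first exact: hk.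
by apply: avg_batch_le => // I; apply: IH => //; apply: (proxP _).1.
Qed.

Lemma epochs_E_linear s x : linear_functional (epochs_E grad b m eta prox s x).
Proof.
elim: s x => [|s IH] x a k1 k2 //=.
rewrite -IH; congr epochs_E; apply: functional_extensionality => y.
exact: inner_E_linear.
Qed.

Lemma epochs_E_monotone s x : hdom x ->
  monotone_functional (epochs_E grad b m eta prox s x).
Proof.
move=> hx; elim: s => [|s IH] k1 k2 hk /=; first exact: hk.
by apply: IH => y hy; apply: inner_E_monotone.
Qed.

Lemma proxsvrg_E_linear T x : linear_functional (proxsvrg_E grad b m eta prox T x).
Proof.
move=> a k1 k2; rewrite /proxsvrg_E; set c := / _.
set A := (X in _ = a * (c * X) + _); set B := (X in _ = _ + c * X).
have -> : a * (c * A) + c * B = c * (a * A + B) by ring.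
congr (_ * _); rewrite /A /B -sumR_scale -sumR_add; apply: eq_bigr => s _.
rewrite -sumR_scale -sumR_add; apply: eq_bigr => t _.
rewrite -epochs_E_linear; congr epochs_E; apply: functional_extensionality => y.
exact: inner_E_linear.
Qed.

Lemma proxsvrg_E_monotone T x : (0 < T)%N -> hdom x ->
  monotone_functional (proxsvrg_E grad b m eta prox T x).
Proof.
move=> T0 hx k1 k2 hk; rewrite /proxsvrg_E.
apply: Rmult_le_compat_l.
  apply: Rlt_le; apply: Rinv_0_lt_compat; apply: INR_gt0; rewrite muln_gt0 m0 andbT.
  by case: T T0 => // T _; rewrite divn_gt0 // addSn leq_addl.
apply: sumR_le => s; apply: sumR_le => t.
by apply: epochs_E_monotone => // y hy; apply: inner_E_monotone.
Qed.

(** * Descent over an inner loop, over epochs and over restarts *)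

Lemma inner_descent xt x j : (j <= m)%N -> hdom x ->
  \big[Rplus/0]_(t < j) (eta * mu / 3 * inner_E grad b eta prox xt (G xt) t x gap)
  + inner_E grad b eta prox xt (G xt) j x gap
  <= gap x + lyap_coef j * dot (vsub x xt) (vsub x xt).
Proof.
elim: j x => [|j IH] x hj hx.
  by rewrite big_ord0 /= /lyap_coef /=; lra.
(* The first step is peeled off: [vr_step_descent] pays for the term at time 0, and the induction
   continues from the random next iterate with the same snapshot. *)
rewrite big_ord_recl /= -(avg_batch_sum (b := b) _ (eta * mu / 3)
  (fun (t : 'I_j) I => inner_E grad b eta prox xt (G xt) t (vr_step grad eta prox xt (G xt) x I) gap)).
have := vr_step_descent xt (ltnW hj) hx.
set V := avg_batch _ => hV; set A := avg_batch _; set B := avg_batch _.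
suff : A + B <= V by lra.
rewrite -[A]Rmult_1_l -avg_batch_linear; apply: avg_batch_le => // I.
by rewrite Rmult_1_l; apply: IH; [apply: ltnW | apply: (proxP _).1].
Qed.

(** An epoch starts at its own snapshot, so the Lyapunov term vanishes there; at the end
    [lyap_coef 0 = 0]. Consecutive epochs therefore chain through [gap] alone. *)
Lemma epoch_descent y : hdom y ->
  \big[Rplus/0]_(t < m) (eta * mu / 3 * inner_E grad b eta prox y (G y) t y gap)
  + epoch_E grad b m eta prox y gap <= gap y.
Proof.
move=> hy; have := inner_descent y (leqnn m) hy.
have -> : dot (vsub y y) (vsub y y) = 0 by rewrite !dotE; ring.
by rewrite /epoch_E -/G; lra.
Qed.

Lemma epochs_descent x S : hdom x ->
  \big[Rplus/0]_(s < S) epochs_E grad b m eta prox s x (fun y =>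
     \big[Rplus/0]_(t < m) (eta * mu / 3 * inner_E grad b eta prox y (G y) t y gap))
  + epochs_E grad b m eta prox S x gap <= gap x.
Proof.
move=> hx; elim: S => [|S IH]; first by rewrite big_ord0 /=; lra.
rewrite big_ord_recr /=; apply: Rle_trans IH; rewrite Rplus_assoc.
apply: Rplus_le_compat_l.
rewrite -[X in X + _]Rmult_1_l -epochs_E_linear; apply: epochs_E_monotone => // y hy.
by rewrite Rmult_1_l; apply: epoch_descent.
Qed.

(** The average gap over the [S m] iterates is at most [3 gap x / (eta mu S m)], and
    [S m >= T >= 6 / (eta mu)]. *)
Lemma proxsvrg_half T x : (0 < T)%N -> 6 <= INR T * (eta * mu) -> hdom x ->
  proxsvrg_E grad b m eta prox T x gap <= gap x / 2.
Proof.
move=> T0 hT hx; rewrite /proxsvrg_E; set S := (_ %/ m)%N.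
(* [S] is the ceiling of [T / m], so the epochs cover at least [T] steps. *)
have hTS : (T <= S * m)%N.
  have := ltn_ceil (T + m).-1 m0; rewrite -/S mulSn.
  by rewrite prednK ?addn_gt0 ?T0 // (addnC m) leq_add2r.
have hN : INR T <= INR (S * m) by apply: le_INR; apply/leP.
have hN0 : 0 < INR T by apply: INR_gt0.
have := epochs_descent S hx.
rewrite (eq_bigr (fun s : 'I_S => eta * mu / 3 * \big[Rplus/0]_(t < m)
   epochs_E grad b m eta prox s x (fun y => inner_E grad b eta prox y (G y) t y gap))); last first.
  by move=> s _; rewrite linear_functional_sum //; apply: epochs_E_linear.
rewrite sumR_scale -/G; set A := \big[_/_]_(s < S) _ => h.
have hE : 0 <= epochs_E grad b m eta prox S x gap.
  rewrite -(linear_functional0 (@epochs_E_linear S x)).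
  by apply: epochs_E_monotone => // y; apply: gap_ge0.
have hg := gap_ge0 hx; have hem : 0 < eta * mu by apply: Rmult_lt_0_compat.
apply: (Rmult_le_reg_l (INR (S * m))); first lra.
rewrite -Rmult_assoc Rinv_r ?Rmult_1_l; last by lra.
apply: (Rmult_le_reg_l (eta * mu / 3)); first lra.
apply: Rle_trans (_ : _ <= gap x) _; first lra.
have : 6 <= INR (S * m) * (eta * mu) by apply: Rle_trans hT _; apply: Rmult_le_compat_r; lra.
move=> h6; have := Rmult_le_compat_r _ _ _ hg h6; lra.
Qed.

Lemma plsvrg_linear_rate T K x : (0 < T)%N -> 6 <= INR T * (eta * mu) -> hdom x ->
  plsvrg_E grad b m eta prox T K x gap <= gap x / 2 ^ K.
Proof.
move=> T0 hT; elim: K x => [|K IH] x hx; first by rewrite /= /Rdiv Rinv_1; lra.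
rewrite [plsvrg_E _ _ _ _ _ _ _ _ _]/=.
(* The first run is the outermost expectation, and the induction hypothesis applies at each of its
   outputs. The [+ 0] matches the shape of the linearity law. *)
apply: Rle_trans (proxsvrg_E_monotone T0 hx (k2 := fun y => / 2 ^ K * gap y + 0) _) _.
  by move=> y hy; have := IH y hy; lra.
rewrite (proxsvrg_E_linear T x (/ 2 ^ K) gap (fun=> 0)).
rewrite (linear_functional0 (@proxsvrg_E_linear T x)).
have hp : 0 < / 2 ^ K by apply: Rinv_0_lt_compat; apply: pow_lt; lra.
have := Rmult_le_compat_l _ _ _ (Rlt_le _ _ hp) (proxsvrg_half T0 hT hx).
have -> : gap x / 2 ^ K.+1 = / 2 ^ K * (gap x / 2).
  by rewrite -[2 ^ K.+1]/(2 * 2 ^ K); field; apply: pow_nonzero; lra.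
lra.
Qed.
End Step.

Theorem theorem8 (n d : nat) (f : 'I_n -> vec d -> R) (grad : 'I_n -> vec d -> vec d)
  (L : R) (hdom : vec d -> Prop) (hval : vec d -> R) (xstar : vec d)
  (mu rho : R) (b m T K : nat) (prox : vec d -> vec d) (x0 : vec d) :
  (0 < n)%N -> (0 < d)%N -> 0 < L ->
  (forall i, has_gradient (f i) (grad i)) ->
  (forall i, L_smooth L (grad i)) ->
  proper_ext hdom -> closed_vset hdom -> convex_ext hdom hval -> lsc_ext hdom hval ->
  is_global_min f hdom hval xstar ->
  0 < mu -> is_PL f grad hdom hval mu xstar ->
  (0 < b)%N -> (b <= n)%N -> (0 < m)%N ->
  0 < rho -> rho <= / 5 ->
  4 * rho ^ 2 * INR m ^ 2 / INR b + rho <= 1 ->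
  INR T - 1 < 6 * L / (rho * mu) <= INR T ->
  (forall x, is_prox hdom hval (rho / L) x (prox x)) ->
  hdom x0 ->
  (1 <= K)%N ->
  plsvrg_E grad b m (rho / L) prox T K x0 (fun x => Fval f hval x - Fval f hval xstar)
    <= (Fval f hval x0 - Fval f hval xstar) / 2 ^ K.
Proof.
move=> n0 _ L0 fgrad gradL _ hcl hcv hlsc hmin mu0 hPL b0 _ m0 rho0 rho5 hbatch [_ hT] hprox hx0 _.
have eL : L * (rho / L) = rho by field; lra.
have eta0 : 0 < rho / L by apply: Rdiv_lt_0_compat.
have rm0 : 0 < rho * mu by apply: Rmult_lt_0_compat.
have T0 : (0 < T)%N.
  apply/ltP/INR_lt; apply: Rlt_le_trans hT; apply: Rdiv_lt_0_compat => //=; lra.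
(* With [eta = rho / L], the choice of [T] gives [T >= 6 / (eta mu)]. *)
have hT6 : 6 <= INR T * (rho / L * mu).
  have -> : 6 = 6 * L / (rho * mu) * (rho / L * mu) by field; lra.
  by apply: Rmult_le_compat_r => //; apply: Rlt_le; apply: Rmult_lt_0_compat.
by apply: (@plsvrg_linear_rate n d f grad L hdom hval xstar mu (rho / L)) => //; rewrite eL.
Qed.
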